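(* Consider the system $\dot{\boldsymbol{z}}=A\boldsymbol{z}+B\boldsymbol{\mu}$ (three decoupled double integrators, i.e. $\ddot{\boldsymbol{r}}=\boldsymbol{\mu}$) and let $\delta>0$. Suppose constants $a_1,a_2>0$ are chosen such that the roots of $\lambda^2+a_1\lambda+a_2$ are negative reals $-\lambda_1,-\lambda_2<0$. Then the quadratic program (CBF-QP) described in the context is feasible for all $(t,\boldsymbol{z})\in[\tau_0,\tau_v)\times\mathbb{R}^6$. Furthermore, if $\|\boldsymbol{r}(\tau_0)-\boldsymbol{r}^{\mathrm{ref}}(\tau_0)\|_\infty\le\delta$, $\|\dot{\boldsymbol{r}}(\tau_0)-\dot{\boldsymbol{r}}^{\mathrm{ref}}(\tau_0)+\lambda_1(\boldsymbol{r}(\tau_0)-\boldsymbol{r}^{\mathrm{ref}}(\tau_0))\|_\infty\le\lambda_1\delta$, and the solution $\boldsymbol{\mu}^*$ of (CBF-QP) is locally Lipschitz in $\boldsymbol{z}$, then the input $\boldsymbol{v}_s(t)$ renders $\|\boldsymbol{r}(t)-\boldsymbol{r}^{\mathrm{ref}}(t)\|_\infty\le\delta$ for all $t\in[\tau_0,\tau_v)$. Therefore $\boldsymbol{z}(t)\in\mathcal{S}_h(t)$ for all $t\in[\tau_0,\tau_v)$, where $\mathcal{S}_h(t)=\{\boldsymbol{z}\in\mathbb{R}^6:\|\boldsymbol{r}-\boldsymbol{r}^{\mathrm{ref}}(t)\|_\infty\le\delta\}$.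
   Context: State $\boldsymbol{z}=(x,y,z,\dot x,\dot y,\dot z)^T\in\mathbb{R}^6$, with position $\boldsymbol{r}=(x,y,z)^T$ and velocity $\dot{\boldsymbol{r}}=(\dot x,\dot y,\dot z)^T$; $A=\begin{bmatrix}0_3 & I_3 \\ 0_3 & 0_3\end{bmatrix}$, $B=\begin{bmatrix}0_3 \\ I_3\end{bmatrix}$. Physical input $\boldsymbol{v}=(T,\phi,\theta,\psi)^T$ (normalized thrust, roll, pitch, yaw). The virtual input is $\boldsymbol{\mu}=(\mu_1,\mu_2,\mu_3)^T=\Psi(\boldsymbol{v}):=T\boldsymbol{z}_B-g\boldsymbol{z}_W$, where $g>0$ is gravity, $\boldsymbol{z}_W=(0,0,1)^T$, and $\boldsymbol{z}_B=(\sin\phi\sin\psi+\cos\phi\sin\theta\cos\psi,\ \cos\phi\sin\theta\sin\psi-\sin\phi\cos\psi,\ \cos\phi\cos\theta)^T$. Given yaw $\psi$, $\Psi$ is inverted by $\boldsymbol{v}=\Psi^{-1}(\boldsymbol{\mu},\psi)$ with $T=\sqrt{\mu_1^2+\mu_2^2+(\mu_3+g)^2}$, $\theta=\arctan\frac{\mu_1\cos\psi+\mu_2\sin\psi}{\mu_3+g}$, $\phi=\arctan\frac{\mu_1\sin\psi-\mu_2\cos\psi}{(\mu_3+g)\cos\theta}$. A reference position trajectory $\boldsymbol{r}^{\mathrm{ref}}=(x^{\mathrm{ref}},y^{\mathrm{ref}},z^{\mathrm{ref}})^T$ on $[\tau_0,\tau_v)$ is given, three times continuously differentiable, with reference state $\boldsymbol{z}^{\mathrm{ref}}=(\boldsymbol{r}^{\mathrm{ref}},\dot{\boldsymbol{r}}^{\mathrm{ref}})$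 and reference input $\boldsymbol{v}^{\mathrm{ref}}$ satisfying $\dot{\boldsymbol{z}}^{\mathrm{ref}}=A\boldsymbol{z}^{\mathrm{ref}}+B\Psi(\boldsymbol{v}^{\mathrm{ref}})$ (dynamic feasibility). A nominal (possibly unsafe) controller $\boldsymbol{v}=\pi(\boldsymbol{z})$ is given. (CBF-QP), at $(t,\boldsymbol{z})$: minimize $\|\Psi(\pi(\boldsymbol{z}))-\boldsymbol{\mu}\|_2^2$ over $\boldsymbol{\mu}\in\mathbb{R}^3$ subject to, for each $q\in\{x,y,z\}$ (with $\mu_q$ denoting $\mu_1,\mu_2,\mu_3$ for $q=x,y,z$ respectively), $$\mu_q-\ddot q^{\mathrm{ref}}(t)+a_1(\dot q-\dot q^{\mathrm{ref}}(t))+a_2(q-q^{\mathrm{ref}}(t)-\delta)\le0,$$ $$-\mu_q+\ddot q^{\mathrm{ref}}(t)+a_1(\dot q^{\mathrm{ref}}(t)-\dot q)+a_2(q^{\mathrm{ref}}(t)-q-\delta)\le0.$$ Its solution is denoted $\boldsymbol{\mu}^*=\boldsymbol{\mu}^*(t,\boldsymbol{z})$, and $\boldsymbol{\mu}^*(t)=\boldsymbol{\mu}^*(t,\boldsymbol{z}(t))$ along a trajectory. The safe input is $\boldsymbol{v}_s(t)=\Psi^{-1}(\boldsymbol{\mu}^*(t),\psi(t))$, with $\psi(t)$ the yaw component of $\pi(\boldsymbol{z}(t))$; applying it to the quadcopter means that the virtual input is $\boldsymbol{\mu}^*(t)$, i.e. $\boldsymbol{z}(t)$ is the closed-loop trajectory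 $\dot{\boldsymbol{z}}(t)=A\boldsymbol{z}(t)+B\boldsymbol{\mu}^*(t)$ on $[\tau_0,\tau_v)$. *)

(* Defs.v *)
From mathcomp Require Import all_boot all_order all_algebra.
From mathcomp Require Import all_classical all_reals all_analysis.

Set Implicit Arguments.
Unset Strict Implicit.
Unset Printing Implicit Defensive.

Import Order.TTheory GRing.Theory Num.Theory.
Import numFieldNormedType.Exports.

Local Open Scope classical_set_scope.
Local Open Scope ring_scope.

(* The right end may be +oo. *)
Definition horizon (R : realType) (tau0 : R) (tauv : \bar R) : set R :=
  [set t | tau0 <= t /\ (t%:E < tauv)%E].

(* Derivatives relative to a set D: the difference quotient only uses values of
   f on D, so it is one-sided at an endpoint of D belonging to D. *)
Definition diff_quotient (R : realType) (V : normedModType R)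
    (f : R -> V) (t s : R) : V := (s - t)^-1 *: (f s - f t).

Definition is_deriv_on (R : realType) (V : normedModType R) (D : set R)
    (f : R -> V) (t : R) (df : V) : Prop :=
  diff_quotient f t s @[s --> within D t^'] --> df.

Definition derivable_on (R : realType) (V : normedModType R) (D : set R)
    (f : R -> V) : Prop :=
  forall t, D t -> exists df, is_deriv_on D f t df.

Definition deriv_on (R : realType) (V : normedModType R) (D : set R)
    (f : R -> V) (t : R) : V :=
  lim (diff_quotient f t s @[s --> within D t^']).

Fixpoint class_C (k : nat) (R : realType) (V : normedModType R) (D : set R)
    (f : R -> V) : Prop :=
  if k is k'.+1 then derivable_on D f /\ class_C k' D (deriv_on D f)
  else {within D, continuous f}.

(* States are columns of height 3 + 3, stacking position over velocity. *)
Definition state (R : realType) := 'cV[R]_(3 + 3).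
Definition position (R : realType) (z : state R) : 'cV[R]_3 := usubmx z.
Definition velocity (R : realType) (z : state R) : 'cV[R]_3 := dsubmx z.

Definition sysA (R : realType) : 'M[R]_(3 + 3) :=
  block_mx (0 : 'M[R]_3) 1%:M (0 : 'M[R]_3) 0.
Definition sysB (R : realType) : 'M[R]_(3 + 3, 3) := col_mx 0 1%:M.

Record input (R : realType) :=
  Input { thrust : R; roll : R; pitch : R; yaw : R }.

Definition vec3 (R : realType) (a b c : R) : 'cV[R]_3 :=
  \col_(i < 3) [:: a; b; c]`_i.

Definition axis_W (R : realType) : 'cV[R]_3 := vec3 0 0 1.

Definition axis_B (R : realType) (v : input R) : 'cV[R]_3 :=
  let phi := roll v in let theta := pitch v in let psi := yaw v in
  vec3 (sin phi * sin psi + cos phi * sin theta * cos psi)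
       (cos phi * sin theta * sin psi - sin phi * cos psi)
       (cos phi * cos theta).

Definition Psi (R : realType) (g : R) (v : input R) : 'cV[R]_3 :=
  thrust v *: axis_B v - g *: axis_W R.

(* Division by zero returns 0, so the formula is total; it is a right inverse
   of [Psi g] where mu_3 + g > 0, but not everywhere. *)
Definition Psi_inv (R : realType) (g : R) (mu : 'cV[R]_3) (psi : R) : input R :=
  let mu1 := mu (inord 0) 0 in
  let mu2 := mu (inord 1) 0 in
  let mu3 := mu (inord 2) 0 in
  let theta := atan ((mu1 * cos psi + mu2 * sin psi) / (mu3 + g)) in
  {| thrust := Num.sqrt (mu1 ^+ 2 + mu2 ^+ 2 + (mu3 + g) ^+ 2);
     roll := atan ((mu1 * sin psi - mu2 * cos psi) / ((mu3 + g) * cos theta));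
     pitch := theta;
     yaw := psi |}.

Definition ref_state (R : realType) (D : set R) (rref : R -> 'cV[R]_3) (t : R) :
    state R := col_mx (rref t) (deriv_on D rref t).

Definition dynamically_feasible (R : realType) (D : set R) (g : R)
    (rref : R -> 'cV[R]_3) (vref : R -> input R) : Prop :=
  forall t, D t ->
    is_deriv_on D (ref_state D rref) t
      (sysA R *m ref_state D rref t + sysB R *m Psi g (vref t)).

(* The norm `| | that the library puts on matrices is the sup norm, so the
   Euclidean norm is needed separately. *)
Definition norm2 (R : realType) (n : nat) (x : 'cV[R]_n) : R :=
  Num.sqrt (\sum_(i < n) x i 0 ^+ 2).

Definition cbf_constraints (R : realType) (D : set R) (rref : R -> 'cV[R]_3)
    (a1 a2 delta : R) (t : R) (z : state R) (mu : 'cV[R]_3) : Prop :=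
  let dref := deriv_on D rref in
  let ddref := deriv_on D dref in
  forall q : 'I_3,
    mu q 0 - ddref t q 0 + a1 * (velocity z q 0 - dref t q 0)
      + a2 * (position z q 0 - rref t q 0 - delta) <= 0
    /\
    - mu q 0 + ddref t q 0 + a1 * (dref t q 0 - velocity z q 0)
      + a2 * (rref t q 0 - position z q 0 - delta) <= 0.

Definition cbf_solution (R : realType) (D : set R) (g : R)
    (pi : state R -> input R) (rref : R -> 'cV[R]_3) (a1 a2 delta : R)
    (t : R) (z : state R) (mu : 'cV[R]_3) : Prop :=
  cbf_constraints D rref a1 a2 delta t z mu /\
  forall mu', cbf_constraints D rref a1 a2 delta t z mu' ->
    norm2 (Psi g (pi z) - mu) ^+ 2 <= norm2 (Psi g (pi z) - mu') ^+ 2.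

Definition locally_lipschitz (R : realType) (V W : normedModType R)
    (f : V -> W) : Prop :=
  forall x : V, exists2 U : set V, nbhs x U & [lipschitz f y | y in U].

(* Applying the safe input vs means that the virtual input is mustar itself;
   the dynamics are not driven by [Psi g (vs t)], which may differ from mustar
   where mu_3 + g <= 0. *)
Definition closed_loop (R : realType) (D : set R) (g : R)
    (pi : state R -> input R) (mustar : R -> state R -> 'cV[R]_3)
    (vs : R -> input R) (z : R -> state R) : Prop :=
  forall t, D t ->
    vs t = Psi_inv g (mustar t (z t)) (yaw (pi (z t))) /\
    is_deriv_on D z t (sysA R *m z t + sysB R *m mustar t (z t)).

Definition safe_set (R : realType) (rref : R -> 'cV[R]_3) (delta t : R) :
    set (state R) := [set z | `|position z - rref t| <= delta].

(* Main.v *)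
(** For each coordinate, put e = q - q^ref. The two constraints bound e and - e
    in the same way: since a1 = l1 + l2 and a2 = l1 * l2, the first one says that
    k = e' + l1 e satisfies k' + l2 k <= l2 (l1 delta). An integrating factor
    propagates k <= l1 delta from the initial time, and this inequality in turn
    propagates e <= delta. *)
Require Import Defs.
From mathcomp Require Import all_boot all_order all_algebra.
From mathcomp Require Import all_classical all_reals all_analysis.
From mathcomp Require Import ring lra.

Import Order.TTheory GRing.Theory Num.Theory.
Import numFieldNormedType.Exports.

Local Open Scope classical_set_scope.
Local Open Scope ring_scope.

(** Since [deriv_on] is a [lim], it carries information only where the quotient converges;
    derivability on [D] supplies that convergence. *)
Lemma deriv_onP (R : realType) (V : normedModType R) (D : set R) (f : R -> V)
    (t : R) :
  derivable_on D f -> D t -> is_deriv_on D f t (deriv_on D f t).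
Proof. by move=> fD /fD fDt; apply/cvg_ex. Qed.

(** * Calculus of derivatives relative to a set *)

Section IsDerivOn.
Variables (R : realType) (D : set R).

Lemma is_deriv_onD (V : normedModType R) (f g : R -> V) (t : R) (df dg : V) :
  is_deriv_on D f t df -> is_deriv_on D g t dg ->
  is_deriv_on D (fun s => f s + g s) t (df + dg).
Proof.
rewrite /is_deriv_on => fD gD.
rewrite (_ : diff_quotient _ t = diff_quotient f t \+ diff_quotient g t).
  exact: cvgD.
by apply/funext => s; rewrite /diff_quotient /= -scalerDr addrACA -opprD.
Qed.

Lemma is_deriv_onZ (V : normedModType R) (c : R) (f : R -> V) (t : R) (df : V) :
  is_deriv_on D f t df -> is_deriv_on D (fun s => c *: f s) t (c *: df).
Proof.
rewrite /is_deriv_on => fD.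
rewrite (_ : diff_quotient _ t = fun s => c *: diff_quotient f t s).
  exact: cvgZl_tmp.
by apply/funext => s; rewrite /diff_quotient -scalerBr !scalerA mulrC.
Qed.

Lemma is_deriv_onN (V : normedModType R) (f : R -> V) (t : R) (df : V) :
  is_deriv_on D f t df -> is_deriv_on D (fun s => - f s) t (- df).
Proof.
move=> /(is_deriv_onZ _ (-1)); rewrite scaleN1r.
by under eq_fun do rewrite scaleN1r.
Qed.

Lemma is_deriv_on_coord m n (f : R -> 'M[R]_(m, n)) (t : R)
    (df : 'M[R]_(m, n)) i j :
  is_deriv_on D f t df -> is_deriv_on D (fun s => f s i j) t (df i j).
Proof.
rewrite /is_deriv_on => fD.
rewrite (_ : diff_quotient _ t = (fun M => M i j) \o diff_quotient f t).
  exact: (cvg_comp _ _ fD (@coord_continuous _ _ _ i j df)).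
by apply/funext => s; rewrite /diff_quotient /= !mxE.
Qed.

(** Away from [t], [f s] equals [f t] plus [s - t] times the quotient, and this product tends to
    [0 * df]. It serves at the initial time, where the derivative is only one-sided. *)
Lemma is_deriv_on_continuous (f : R -> R) (t df : R) :
  is_deriv_on D f t df -> f s @[s --> within D t^'] --> f t.
Proof.
move=> fD.
have idc : s - t @[s --> within D t^'] --> (0 : R).
  rewrite -(subrr t); apply: cvgB; last exact: cvg_cst.
  by apply: cvg_trans (@nbhs_dnbhs _ t); apply: cvg_within.
have fdq : f t + (s - t) * diff_quotient f t s @[s --> within D t^'] --> f t.
  rewrite -[X in _ --> X]addr0 -(mul0r df).
  by apply: cvgD; [exact: cvg_cst|exact: cvgM].
apply: (cvg_trans _ fdq); apply: near_eq_cvg; rewrite near_withinE.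
have : \forall s \near t^', s != t by exact: nbhs_dnbhs_neq.
apply: filterS => s s_neq _; rewrite /diff_quotient /GRing.scale /=.
by rewrite mulrA divff ?subr_eq0// mul1r subrKC.
Qed.

(** When [D] is a neighbourhood of [t], restricting to [D] does not change the punctured filter at
    [t]. This gives access to the monotonicity criteria stated for ordinary derivatives. *)
Lemma is_deriv_on_interior (f : R -> R) (t df : R) :
  nbhs t D -> is_deriv_on D f t df -> is_derive t 1 f df.
Proof.
move=> Dt fD.
(* The ordinary derivative is a limit in the increment [h] at 0; translation by [t] turns it into a
   limit in [s] at [t], preserving the puncture and eventually landing in [D]. *)
have shift_cvg : h *: 1 + t @[h --> 0^'] --> within D t^'.
  have c : h *: (1 : R) + t @[h --> (0 : R)] --> t.
    rewrite -[X in _ --> X]add0r; under eq_fun do rewrite /GRing.scale /= mulr1.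
    by apply: cvgD; [exact: cvg_id|exact: cvg_cst].
  move=> P tP.
  have {}tP : \forall s \near t, s != t -> P s.
    by apply: filterS2 Dt tP => s Ds sP s_neq; exact: sP.
  have {}tP : \forall h \near (0 : R), h *: 1 + t != t -> P (h *: 1 + t).
    exact: c tP.
  have tP0 : \forall h \near (0 : R)^', P (h *: 1 + t).
    rewrite near_withinE; apply: filterS tP => h Ph h_neq.
    by apply: Ph; rewrite -subr_eq0 addrK /GRing.scale /= mulr1.
  exact: tP0.
have fd : h^-1 *: ((f \o shift t) (h *: 1) - f t) @[h --> 0^'] --> df.
  apply: (cvg_trans _ (cvg_comp _ _ shift_cvg fD)).
  apply: near_eq_cvg; near=> h.
  by rewrite /diff_quotient /= addrK /GRing.scale /= mulr1.
by split; [apply/cvg_ex; exists df|exact: cvg_lim].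
Unshelve. all: by end_near. Qed.

End IsDerivOn.

Lemma nbhs_horizon (R : realType) (tau0 : R) (tauv : \bar R) (t : R) :
  tau0 < t -> (t%:E < tauv)%E -> nbhs t (horizon tau0 tauv).
Proof.
move=> t0t ttv; rewrite /horizon.
have t0s : \forall s \near t, tau0 <= s.
  by near=> s; apply: ltW; near: s; exact: lt_nbhsr.
have stv : \forall s \near t, (s%:E < tauv)%E.
  case: tauv ttv => [b||] //= ttv; last by near=> s; rewrite ltry.
  by near=> s; rewrite lte_fin; near: s; apply: lt_nbhsl.
by near=> s; split; near: s.
Unshelve. all: by end_near. Qed.

(** * Differential inequalities on the horizon *)

Section Comparison.
Variables (R : realType) (tau0 : R) (tauv : \bar R).
Let D := horizon tau0 tauv.

(** The function [expR (l * s) * (f s - c)] has derivative [expR (l * s) * (df s + l * f s - l * c)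
    <= 0], so it is nonincreasing, and it starts nonpositive. *)
Lemma relaxation_le (l c : R) (f df : R -> R) :
  (forall t, D t -> is_deriv_on D f t (df t)) ->
  (forall t, D t -> df t + l * f t <= l * c) ->
  f tau0 <= c -> forall t, D t -> f t <= c.
Proof.
move=> fD fle f0 t [t0t ttv].
move: t0t; rewrite le_eqVlt => /orP[/eqP <- //|t0t].
have Ds s : tau0 <= s <= t -> D s.
  by case/andP=> t0s st; split=> //; rewrite (le_lt_trans _ ttv)// lee_fin.
have D0 : D tau0 by apply: Ds; rewrite lexx ltW.
pose g s := expR (l * s) * (f s - c).
have gD s : tau0 < s <= t ->
    is_derive s 1 g (expR (l * s) * (df s + l * f s - l * c)).
  case/andP=> t0s st.
  have [_ stv] : D s by apply: Ds; rewrite ltW.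
  have fDs := is_deriv_on_interior _ _ _ _ _ (nbhs_horizon _ _ _ _ t0s stv)
    (fD _ (Ds _ (introT andP (conj (ltW t0s) st)))).
  apply: is_derive_eq; rewrite /GRing.scale /=; ring.
have g_cont s : tau0 < s <= t -> {for s, continuous g}.
  move=> /gD gDs; apply: differentiable_continuous.
  by apply/derivable1_diffP; case: gDs.
(* The horizon is not a neighbourhood of [tau0], so only right-continuity holds there. Points
   between [tau0] and [t] lie in [D], hence the limit within [D] yields the right limit. *)
have g0_cont : g s @[s --> tau0^'+] --> g tau0.
  apply: cvgM.
    apply: cvg_at_right_filter.
    apply: continuous_comp; last exact: continuous_expR.
    by apply: cvgM; [exact: cvg_cst|exact: cvg_id].
  apply: cvgB; last exact: cvg_cst.
  apply: cvg_trans (is_deriv_on_continuous _ _ _ _ _ (fD _ D0)).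
  apply: cvg_app => P DP.
  have st : \forall s \near tau0, s < t by exact: lt_nbhsl.
  have {}DP : \forall s \near tau0, s != tau0 -> D s -> P s by exact: DP.
  suff DP' : \forall s \near tau0, tau0 < s -> P s by exact: DP'.
  apply: filterS2 DP st => s DP st t0s; apply: DP; first by rewrite gt_eqF.
  by apply: Ds; rewrite !ltW.
have : g t <= g tau0.
  apply: (@ler0_derive1_le_cc _ g tau0 t); rewrite ?in_itv /= ?lexx ?ltW//.
  - by move=> s; rewrite in_itv /= => /andP[t0s /ltW st]; case: (gD s) => //;
      rewrite t0s.
  - move=> s; rewrite in_itv /= => /andP[t0s /ltW st].
    have sI : tau0 < s <= t by rewrite t0s.
    rewrite derive1E; case: (gD _ sI) => _ ->.
    by rewrite pmulr_rle0 ?expR_gt0// subr_le0 fle//; apply: Ds; rewrite ltW.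
  - apply/continuous_within_itvP => //; split => //.
    + by move=> s; rewrite in_itv /= => /andP[t0s /ltW st];
        apply: g_cont; rewrite t0s.
    + by apply: cvg_at_left_filter; apply: g_cont; rewrite t0t lexx.
rewrite /g => gle.
have : expR (l * t) * (f t - c) <= 0.
  by rewrite (le_trans gle)// pmulr_rle0 ?expR_gt0// subr_le0.
by rewrite pmulr_rle0 ?expR_gt0// subr_le0.
Qed.

Lemma second_order_cbf_le (l1 l2 c : R) (e e' e'' : R -> R) :
  (forall t, D t -> is_deriv_on D e t (e' t)) ->
  (forall t, D t -> is_deriv_on D e' t (e'' t)) ->
  (forall t, D t -> e'' t + (l1 + l2) * e' t + l1 * l2 * (e t - c) <= 0) ->
  e tau0 <= c -> e' tau0 + l1 * e tau0 <= l1 * c ->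
  forall t, D t -> e t <= c.
Proof.
move=> eD e'D ele e0 e'0.
apply: (relaxation_le l1 c e e') => //.
(* For [k = e' + l1 * e], one has [k' + l2 * k = e'' + (l1 + l2) * e' + l1 * l2 * e], which the
   hypothesis bounds by [l2 * (l1 * c)]. *)
apply: (relaxation_le l2 (l1 * c) _ (fun s => e'' s + l1 * e' s)) => // s Ds.
  by apply: is_deriv_onD; [exact: e'D|apply: is_deriv_onZ; exact: eD].
by have := ele s Ds; lra.
Qed.

End Comparison.

(** * Reduction of vectors and polynomials to scalars *)

Lemma matrix_norm_leP (R : realType) m n (A : 'M[R]_(m, n)) (c : R) :
  0 <= c -> (`|A| <= c <-> forall i j, `|A i j| <= c).
Proof.
(* The norm is an iterated maximum with default value 0, which is where [0 <= c] enters. *)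
move=> c0; rewrite {1}/Num.norm /= mx_normrE.
split=> [/bigmax_leP[_ Ac] i j|Ac].
  exact: (Ac (i, j)).
by apply/bigmax_leP; split=> // -[i j] _; exact: Ac.
Qed.

Lemma closed_loop_rhs (R : realType) (x : state R) (mu : 'cV[R]_3) :
  sysA R *m x + sysB R *m mu = col_mx (velocity x) mu.
Proof.
rewrite /sysA /sysB -[X in _ *m X + _]vsubmxK mul_block_col mul_col_mx.
by rewrite !mul0mx !mul1mx !add0r add_col_mx addr0 add0r.
Qed.

Lemma quadratic_roots_coef (R : realType) (a1 a2 l1 l2 : R) :
  'X^2 + a1 *: 'X + a2%:P = ('X - (- l1)%:P) * ('X - (- l2)%:P) :> {poly R} ->
  a1 = l1 + l2 /\ a2 = l1 * l2.
Proof.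
move=> E.
have E0 : a2 = l1 * l2.
  (* Evaluation at 0 gives the product of the roots; evaluation at 1 then gives [a1]. *)
  by have := congr1 (horner^~ 0) E; rewrite !hornerE /=; lra.
by split=> //; have := congr1 (horner^~ 1) E; rewrite !hornerE /= E0; lra.
Qed.

(** * Feasibility of the program and safety of the closed loop *)

Theorem theorem2 (R : realType) (tau0 : R) (tauv : \bar R) (g delta : R)
    (rref : R -> 'cV[R]_3) (vref : R -> input R) (pi : state R -> input R)
    (a1 a2 lambda1 lambda2 : R)
    (htau : (tau0%:E < tauv)%E) (hg : 0 < g) (hdelta : 0 < delta)
    (hrref : class_C 3 (horizon tau0 tauv) rref)
    (hvref : dynamically_feasible (horizon tau0 tauv) g rref vref)
    (ha1 : 0 < a1) (ha2 : 0 < a2)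
    (hlambda1 : - lambda1 < 0) (hlambda2 : - lambda2 < 0)
    (hroots : 'X^2 + a1 *: 'X + a2%:P
              = ('X - (- lambda1)%:P) * ('X - (- lambda2)%:P) :> {poly R}) :
  (forall (t : R) (z : state R), horizon tau0 tauv t ->
     exists mu : 'cV[R]_3,
       cbf_constraints (horizon tau0 tauv) rref a1 a2 delta t z mu)
  /\
  (forall (mustar : R -> state R -> 'cV[R]_3) (vs : R -> input R)
          (z : R -> state R),
     (forall (t : R) (x : state R), horizon tau0 tauv t ->
        cbf_solution (horizon tau0 tauv) g pi rref a1 a2 delta t x
          (mustar t x)) ->
     (forall t : R, horizon tau0 tauv t ->
        locally_lipschitz (mustar t)) ->
     closed_loop (horizon tau0 tauv) g pi mustar vs z ->
     `|position (z tau0) - rref tau0| <= delta ->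
     `|velocity (z tau0) - deriv_on (horizon tau0 tauv) rref tau0
        + lambda1 *: (position (z tau0) - rref tau0)| <= lambda1 * delta ->
     (forall t : R, horizon tau0 tauv t ->
        `|position (z t) - rref t| <= delta)
     /\
     (forall t : R, horizon tau0 tauv t ->
        safe_set rref delta t (z t))).
Proof.
have [a1E a2E] := quadratic_roots_coef _ _ _ _ _ hroots.
split=> [t z Dt|mustar vs z mustarP _ cl pos0 vel0].
  rewrite /cbf_constraints /=.
  set dref := deriv_on _ rref; set ddref := deriv_on _ dref.
  (* This choice makes the two constraints on each coordinate both equal to
     [- a2 * delta <= 0]. *)
  exists (\col_q (ddref t q 0 - a1 * (velocity z q 0 - dref t q 0)
    - a2 * (position z q 0 - rref t q 0))) => q.
  rewrite mxE; have := mulr_gt0 ha2 hdelta.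
  by split; lra.
(* Membership in [safe_set] unfolds to the same inequality as the norm bound. *)
suff safe t : horizon tau0 tauv t -> `|position (z t) - rref t| <= delta.
  by split.
set D := horizon tau0 tauv in hrref cl vel0 mustarP *.
pose dref := deriv_on D rref; pose ddref := deriv_on D dref.
have l1delta : 0 <= lambda1 * delta by rewrite mulr_ge0// ltW//; lra.
case: hrref => rrefD [drefD _].
(* The closed-loop right-hand side stacks [velocity] over [mustar]: its upper rows differentiate the
   position, its lower rows the velocity. *)
have posD (q : 'I_3) s : D s ->
    is_deriv_on D (fun u => position (z u) q 0) s (velocity (z s) q 0).
  move=> /cl[_]; rewrite closed_loop_rhs.
  move=> /(is_deriv_on_coord _ _ _ _ _ _ _ (lshift 3 q) 0); rewrite col_mxEu.
  by under [X in is_deriv_on _ X]eq_fun do rewrite -[z _]vsubmxK col_mxEu.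
have velD (q : 'I_3) s : D s ->
    is_deriv_on D (fun u => velocity (z u) q 0) s (mustar s (z s) q 0).
  move=> /cl[_]; rewrite closed_loop_rhs.
  move=> /(is_deriv_on_coord _ _ _ _ _ _ _ (rshift 3 q) 0); rewrite col_mxEd.
  by under [X in is_deriv_on _ X]eq_fun do rewrite -[z _]vsubmxK col_mxEd.
have refD (q : 'I_3) s : D s ->
    is_deriv_on D (fun u => rref u q 0) s (dref s q 0).
  by move=> Ds; apply: is_deriv_on_coord; exact: deriv_onP.
have drefD' (q : 'I_3) s : D s ->
    is_deriv_on D (fun u => dref u q 0) s (ddref s q 0).
  by move=> Ds; apply: is_deriv_on_coord; exact: deriv_onP.
pose e q s := position (z s) q 0 - rref s q 0.
pose de q s := velocity (z s) q 0 - dref s q 0.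
pose dde q s := mustar s (z s) q 0 - ddref s q 0.
have eD q s : D s -> is_deriv_on D (e q) s (de q s).
  by move=> Ds; apply/is_deriv_onD/is_deriv_onN/refD => //; exact: posD.
have deD q s : D s -> is_deriv_on D (de q) s (dde q s).
  by move=> Ds; apply/is_deriv_onD/is_deriv_onN/drefD' => //; exact: velD.
have eE q s : (position (z s) - rref s) q 0 = e q s by rewrite /e !mxE.
have deE q s :
    (velocity (z s) - dref s + lambda1 *: (position (z s) - rref s)) q 0 =
    de q s + lambda1 * e q s by rewrite /de /e !mxE.
move=> Dt; apply/matrix_norm_leP => [|q j]; first exact: ltW.
move/matrix_norm_leP: pos0 => /(_ (ltW hdelta) q 0).
move/matrix_norm_leP: vel0 => /(_ l1delta q 0).
rewrite ord1 -/dref deE !eE !ler_norml => /andP[vel0l vel0u] /andP[pos0l pos0u].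
(* The lower bound on [e] is the upper bound on [- e], whose initial conditions are the lower halves
   of the two norm bounds. *)
apply/andP; split; first rewrite lerNl.
  apply: (second_order_cbf_le _ tau0 tauv lambda1 lambda2 delta
    (fun s => - e q s) (fun s => - de q s) (fun s => - dde q s)) Dt.
  - by move=> s Ds; apply: is_deriv_onN; exact: eD.
  - by move=> s Ds; apply: is_deriv_onN; exact: deD.
  (* Since the second derivative of the position is [mustar], the second constraint reads [- dde +
     a1 * (- de) + a2 * (- e - delta) <= 0]. *)
  - move=> s Ds; have [/(_ q)[_ + _]] := mustarP s (z s) Ds.
    by rewrite a1E a2E -/dref -/ddref /e /de /dde; lra.
  - lra.
  - lra.
apply: (second_order_cbf_le _ tau0 tauv lambda1 lambda2 delta
  (e q) (de q) (dde q)) Dt => //.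
- exact: eD.
- exact: deD.
(* Likewise the first constraint reads [dde + a1 * de + a2 * (e - delta) <= 0]. *)
- move=> s Ds; have [/(_ q)[+ _ _]] := mustarP s (z s) Ds.
  by rewrite a1E a2E -/dref -/ddref /e /de /dde; lra.
Qed.
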